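(* Let $F$ be a field with $\operatorname{char}F\nmid 30$ (characteristic $0$ allowed). Every unital $(2,3)$-palintropic $F$-algebra is power-associative.
   Context: Algebras are commutative, not necessarily associative, possibly infinite-dimensional. A commutative algebra is $(2,3)$-palintropic if $(x^3)^2-(x^2)^3=0$ for all $x$, where $x^2=xx$, $x^3=x(xx)$, $(x^3)^2=x^3x^3$, $(x^2)^3=x^2(x^2x^2)$. It is power-associative if the subalgebra generated by any single element is associative. *)

(* Defs.v *)
From mathcomp Require Import all_boot all_order all_algebra.

Set Implicit Arguments.
Unset Strict Implicit.
Unset Printing Implicit Defensive.

Import GRing.Theory.
Local Open Scope ring_scope.

(* MathComp's ring and algebra structures are associative, so a not necessarily
   associative F-algebra is given as an F-module with a bilinear product
   [mul : {bilinear A -> A -> A}]. *)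
Section NonassociativeAlgebra.

Variables (F : fieldType) (A : lmodType F) (mul : A -> A -> A).

Definition asquare (x : A) : A := mul x x.
Definition acube (x : A) : A := mul x (mul x x).

Definition palintropic23 : Prop :=
  forall x : A, asquare (acube x) - acube (asquare x) = 0.

Definition unital : Prop := exists e : A, left_id e mul /\ right_id e mul.

(* Subsets are Prop-valued, so that no decidability is required of them;
   a subalgebra is not required to contain the unit of A. *)
Record subalgebra (S : A -> Prop) : Prop := Subalgebra {
  subalgebra0 : S 0;
  subalgebraD : forall u v : A, S u -> S v -> S (u + v);
  subalgebraZ : forall (a : F) (u : A), S u -> S (a *: u);
  subalgebraM : forall u v : A, S u -> S v -> S (mul u v)
}.

Definition generated_subalgebra (x : A) : A -> Prop :=
  fun y => forall S : A -> Prop, subalgebra S -> S x -> S y.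

Definition power_associative : Prop :=
  forall x u v w : A,
    generated_subalgebra x u -> generated_subalgebra x v ->
    generated_subalgebra x w ->
    mul u (mul v w) = mul (mul u v) w.

End NonassociativeAlgebra.

(* Main.v *)
Require Import Defs.
From HB Require Import structures.
From mathcomp Require Import all_boot all_order all_algebra ring zify.

Set Implicit Arguments.
Unset Strict Implicit.
Unset Printing Implicit Defensive.

Import GRing.Theory.
Local Open Scope ring_scope.

(** The idea is to recover, from the degree-6 identity and the unit [e], the
    degree-4 identity x^2 x^2 = x^4 (powers being right-normed,
    x^(n+1) = x x^n), and then to follow Albert's argument that, away from
    characteristics 2, 3 and 5, this identity alone forces x^i x^j = x^(i+j).

    Evaluating (X^3)^2 = (X^2)^3 at X = e + t y, both sides are polynomials in t
    of degree at most 6 with coefficients in the algebra. The scalars 0, ..., 6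
    are pairwise distinct in [F], so the coefficients agree; the parts of degree
    at most 3 are trivial, and degree 4 reads 2 (y^2 y^2 - y y^3) = 0
    ([albert_of_palintropic]). The same comparison of coefficients, now in
    degree 1, polarizes x^2 x^2 = x x^3 twice and gives an identity of type
    (2,1,1) in x, y, z ([albert211]).

    Suppose that x^i x^j = x^(i+j) whenever i + j < n, and let
    d k = x^k x^(n-k) - x^n. Substituting powers x^a, x^b, x^c with
    2a + b + c = n in the polarized identity turns it into the linear relation
      4 d(2a) + 8 d(a+b) = 6 d(a) + 3 d(b) + 3 d(c).
    Together with d 1 = 0 and the symmetry d k = d (n - k), the relations with
    a = 1, namely
      4 d 2 + 8 d(b+1) = 3 d(b) + 3 d(b+2),
    form a linear recurrence that expresses every d k through d 2, and
    comparison with one relation for a = 2 forces 90 d 2 = 0 (for n = 5,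
    d 3 = d 2 and so 9 d 2 = 0); this is where 2, 3 and 5 must be invertible
    ([albert_recurrence]). Hence all d k vanish, which is the induction step of
    [powerD].

    Finally the subalgebra generated by x lies in the image of the polynomials
    under the linear map X^n |-> x^n, which is multiplicative by [powerD], so
    associativity is inherited from polynomial multiplication. *)

(** * Linear maps out of the polynomials *)

Section Umbral.
Variables (F : fieldType) (V : lmodType F) (v : nat -> V).

(** The linear map sending ['X^i] to [v i], as in umbral calculus: a sequence of
    vectors is a linear map defined on the polynomials. *)
Definition umbral (p : {poly F}) : V := \sum_(i < size p) p`_i *: v i.

Lemma umbral_wide (n : nat) (p : {poly F}) :
  (size p <= n)%N -> umbral p = \sum_(i < n) p`_i *: v i.
Proof.
move=> le_p_n; rewrite /umbral (big_ord_widen n (fun i => p`_i *: v i)) //.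
rewrite big_mkcond; apply: eq_bigr => i _.
by case: ltnP => // /(nth_default 0) ->; rewrite scale0r.
Qed.

Lemma umbral_is_linear : linear umbral.
Proof.
move=> a p q; set n := maxn (size (a *: p + q)) (maxn (size p) (size q)).
rewrite !(@umbral_wide n) ?leq_max ?leqnn ?orbT // scaler_sumr -big_split /=.
by apply: eq_bigr => i _; rewrite coefD coefZ scalerDl scalerA.
Qed.

HB.instance Definition _ :=
  GRing.isLinear.Build F {poly F} V *:%R umbral umbral_is_linear.

Lemma umbralXn (n : nat) : umbral 'X^n = v n.
Proof.
rewrite (@umbral_wide n.+1) ?size_polyXn // (bigD1 ord_max) //= coefXn eqxx.
rewrite scale1r big1 ?addr0 // => i; rewrite -val_eqE /= => /negPf ni.
by rewrite coefXn ni scale0r.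
Qed.

End Umbral.

(** Any finite list of vectors is the image of the first powers of ['X]. An
    integral linear identity between these vectors thus follows from the
    same identity between polynomials, which is a commutative ring identity. *)
Lemma umbral_atoms (F : fieldType) (V : lmodType F) (s : seq V) :
  exists h : {linear {poly F} -> V}, forall i : nat, s`_i = h 'X^i.
Proof. by exists (umbral (nth 0 s)) => i; rewrite /= umbralXn. Qed.

(* A vector that contains another vector of the list [s] must precede it, since
   the replaced occurrences disappear. *)
Ltac rewrite_atoms h hE s i :=
  lazymatch s with
  | ?a :: ?s' =>
      let E := fresh "E" in
      have E : a = h 'X^i := hE i; rewrite ?E {E}; rewrite_atoms h hE s' (S i)
  | _ => idtac
  end.

(** Proves an equality between integral linear combinations of the vectors
    listed in [s], by [umbral_atoms]. *)
Ltac linear_identity s :=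
  let h := fresh "h" in let hE := fresh "hE" in
  have [h hE] := umbral_atoms s; rewrite_atoms h hE s 0%N;
  rewrite -?(linear0 h) -?(linearMn h, linearN h, linearD h);
  congr (h _); ring.

(** The form in which a linear consequence of a known equality is proved: what
    remains is an identity for [linear_identity]. *)
Lemma eq_by_sub (V : zmodType) (a b c d : V) : a = b -> c - d = a - b -> c = d.
Proof. by move=> -> /eqP; rewrite subrr subr_eq0 => /eqP. Qed.

(** * Polynomial functions with vector coefficients *)

Section Coefficients.
Variables (F : fieldType) (V : lmodType F).

Fixpoint vhorner (s : seq V) (t : F) : V :=
  if s is v :: s' then v + t *: vhorner s' t else 0.

Lemma vhornerE (n : nat) (s : seq V) (t : F) : (size s <= n)%N ->
  vhorner s t = \sum_(i < n) t ^+ i *: s`_i.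
Proof.
elim: n s => [|n IHn] [|v s] //= le_s_n; rewrite ?big_ord0 //.
  by rewrite big1 // => i _; rewrite nth_nil scaler0.
rewrite big_ord_recl expr0 scale1r IHn // scaler_sumr; congr (_ + _).
by apply: eq_bigr => i _; rewrite scalerA -exprS.
Qed.

(** The Vandermonde matrix of [n] distinct points is invertible, so its inverse
    expresses the coefficients by the values, even when these are vectors. *)
Lemma vhorner_inj (n : nat) (s s' : seq V) (r : 'I_n -> F) :
    injective r -> (size s <= n)%N -> (size s' <= n)%N ->
    (forall k, vhorner s (r k) = vhorner s' (r k)) ->
  forall i, s`_i = s'`_i.
Proof.
move=> r_inj le_s_n le_s'_n eq_s i.
have [lt_i_n|le_n_i] := ltnP i n; last first.
  by rewrite !nth_default // (leq_trans _ le_n_i).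
pose M : 'M[F]_n := Vandermonde n (\row_k r k).
have M_unit : M \in unitmx.
  rewrite unitmxE det_Vandermonde unitfE; apply/prodf_neq0 => j _.
  apply/prodf_neq0 => k lt_j_k; rewrite !mxE subr_eq0 (inj_eq r_inj).
  by rewrite -val_eqE /= neq_ltn lt_j_k orbT.
apply/eqP; rewrite -subr_eq0; apply/eqP.
pose d k := s`_k - s'`_k; rewrite -/(d i).
have d0 k : \sum_(j < n) M j k *: d j = 0.
  transitivity (vhorner s (r k) - vhorner s' (r k)); last by rewrite eq_s subrr.
  rewrite !(@vhornerE n) // -sumrB.
  by apply: eq_bigr => j _; rewrite !mxE scalerBr.
have -> : d i = \sum_k invmx M k (Ordinal lt_i_n) *: \sum_(j < n) M j k *: d j.
  under eq_bigr => k _ do rewrite scaler_sumr.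
  rewrite exchange_big /=.
  transitivity (\sum_(j < n) (M *m invmx M) j (Ordinal lt_i_n) *: d j).
    rewrite mulmxV // (bigD1 (Ordinal lt_i_n)) //= mxE eqxx scale1r.
    by rewrite big1 ?addr0 // => j /negPf nj; rewrite mxE nj scale0r.
  apply: eq_bigr => j _; rewrite mxE scaler_suml; apply: eq_bigr => k _.
  by rewrite scalerA mulrC.
by apply: big1 => k _; rewrite d0 scaler0.
Qed.

Fixpoint addseq (s s' : seq V) : seq V :=
  match s, s' with
  | [::], _ => s'
  | _, [::] => s
  | v :: s, v' :: s' => v + v' :: addseq s s'
  end.

Lemma vhornerD (s s' : seq V) (t : F) :
  vhorner (addseq s s') t = vhorner s t + vhorner s' t.
Proof.
elim: s s' => [|v s IHs] [|v' s'] /=; rewrite ?(add0r, addr0) //.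
by rewrite IHs scalerDr addrACA.
Qed.

Variable mul : {bilinear V -> V -> V}.

(** The Cauchy product. On explicit lists of vectors it computes, and so it
    expands products of polynomial functions into their coefficients. *)
Fixpoint mulseq (s s' : seq V) : seq V :=
  if s is v :: s1 then addseq (map (mul v) s') (0 :: mulseq s1 s') else [::].

Lemma vhornerM (s s' : seq V) (t : F) :
  vhorner (mulseq s s') t = mul (vhorner s t) (vhorner s' t).
Proof.
have mulv v : vhorner (map (mul v) s') t = mul v (vhorner s' t).
  elim: s' => [|v' s1 IHs] /=; first by rewrite linear0r.
  by rewrite IHs linearDr linearZr_LR.
elim: s => [|v s IHs] /=; first by rewrite linear0l.
by rewrite vhornerD /= add0r IHs mulv linearDl linearZl_LR.
Qed.

End Coefficients.

(** * The use of the characteristic *)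

Section Characteristic.
Variables (F : fieldType) (V : lmodType F).
Hypothesis charF : forall p : nat, p \in [pchar F] -> ~~ (p %| 30)%N.

(** The bound 900 is the square of 30: it is large enough to be a multiple of
    every integer by which the proof divides, and a prime dividing it divides
    30. *)
Lemma natf_neq0_dvd900 (n : nat) : (n %| 900)%N -> n%:R != 0 :> F.
Proof.
move=> n_dvd; have n_gt0 : (0 < n)%N by case: n n_dvd.
apply/negP => n0; have [p charFp] := natf0_pchar n_gt0 n0.
have p_pr := pcharf_prime charFp.
have /negP[] := charF charFp.
suff: (p %| 30 ^ 2)%N by rewrite Euclid_dvdX // andbT.
by rewrite (dvdn_trans _ n_dvd) // (dvdn_pcharf charFp).
Qed.

Lemma mulrn_inj0 (n : nat) (v : V) : (n %| 900)%N -> v *+ n = 0 -> v = 0.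
Proof.
move=> n_dvd /eqP; rewrite -scaler_nat scaler_eq0.
by rewrite (negPf (natf_neq0_dvd900 n_dvd)) => /eqP.
Qed.

Lemma natr7_inj : injective (fun k : 'I_7 => (k : nat)%:R : F).
Proof.
move=> j k; wlog le_jk : j k / (j <= k)%N => [IH|] E.
  by have /orP[/IH|/IH/(_ (esym E))] := leq_total j k; auto.
apply/val_inj/eqP; rewrite eqn_leq le_jk /= -subn_eq0.
have [//|ne] := eqVneq (k - j)%N 0%N.
have d_dvd : (k - j %| 900)%N.
  have : (k - j < 7)%N by rewrite (leq_ltn_trans (leq_subr _ _)).
  by case: (k - j)%N ne => [|[|[|[|[|[|[|]]]]]]].
by have /negP[] := natf_neq0_dvd900 d_dvd; rewrite natrB // E subrr.
Qed.

Lemma vhorner_coefs_eq (s s' : seq V) :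
    vhorner s =1 vhorner s' -> (size s <= 7)%N -> (size s' <= 7)%N ->
  forall i, s`_i = s'`_i.
Proof. by move=> E ? ?; apply: (vhorner_inj natr7_inj) => //. Qed.

End Characteristic.

(** * The identities of degree four *)

Section Identities.
Variables (F : fieldType) (A : lmodType F) (mul : {bilinear A -> A -> A}).
Hypothesis charF : forall p : nat, p \in [pchar F] -> ~~ (p %| 30)%N.
Hypothesis mulC : commutative mul.

(** The coefficients of t^0, ..., t^3 in the identity at [e + t y] are trivial;
    that of t^4 is twice the claim. *)
Lemma albert_of_palintropic (e y : A) :
  left_id e mul -> palintropic23 mul ->
  mul (mul y y) (mul y y) = mul y (mul y (mul y y)).
Proof.
move=> mul1x mulP; have mulx1 x : mul x e = x by rewrite mulC.
pose s := [:: e; y]; pose s2 := mulseq mul s s; pose s3 := mulseq mul s s2.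
have E t : vhorner (mulseq mul s3 s3) t =
           vhorner (mulseq mul s2 (mulseq mul s2 s2)) t.
  apply/eqP; rewrite -subr_eq0 !vhornerM; apply/eqP; exact: mulP.
have /(_ 4%N) := vhorner_coefs_eq charF E isT isT.
rewrite /= !(linearDl, linearDr, linear0l, linear0r, addr0, add0r).
rewrite !(mul1x, mulx1) !(mulC (mul y (mul y y)) y) !(mulC (mul y y) y).
set P := mul y _; set Q := mul (mul y y) _ => PQ.
apply: subr0_eq; apply: (mulrn_inj0 charF (n := 2)) => //.
apply: eq_by_sub PQ _; linear_identity [:: P; Q].
Qed.

Section Albert.
Hypothesis albert :
  forall x : A, mul (mul x x) (mul x x) = mul x (mul x (mul x x)).

(** The coefficient of [t] in the identity at [x + t y]. The integers are put on
    [y] rather than in front of the products so that both sides are sums of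
    products, which [mulseq] can expand again. *)
Lemma albert31 (x y : A) :
  mul (mul x x) (mul x (y *+ 4)) =
  mul y (mul x (mul x x)) + mul x (mul y (mul x x))
  + mul x (mul x (mul x (y *+ 2))).
Proof.
pose s := [:: x; y]; pose s2 := mulseq mul s s; pose s3 := mulseq mul s s2.
have E t : vhorner (mulseq mul s2 s2) t = vhorner (mulseq mul s s3) t.
  by rewrite !vhornerM albert.
have /(_ 1%N) := vhorner_coefs_eq charF E isT isT.
rewrite /= !(addr0, add0r) !(mulC y x) !(mulC _ (mul x x)) !linearDr.
set a := mul (mul x x) (mul x y); set b := mul x (mul x _).
set c := mul x _; set d := mul y _.
move/eq_by_sub; apply; linear_identity [:: a; b; c; d].
Qed.

(** The coefficient of [t] in [albert31] at [x + t z], [y]: the complete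
    polarization of the identity with two arguments equal, which is all that the
    recurrence between powers needs. *)
Lemma albert211 (x y z : A) :
  mul (mul x x) (mul y z) *+ 4 + mul (mul x y) (mul x z) *+ 8 =
  mul x (mul x (mul y z) + mul y (mul x z) + mul z (mul x y)) *+ 2
  + mul y (mul x (mul x z) *+ 2 + mul z (mul x x))
  + mul z (mul x (mul x y) *+ 2 + mul y (mul x x)).
Proof.
pose s := [:: x; z]; pose s2 := mulseq mul s s.
pose l := mulseq mul s2 (mulseq mul s [:: y *+ 4]).
pose r := addseq (addseq (mulseq mul [:: y] (mulseq mul s s2))
                         (mulseq mul s (mulseq mul [:: y] s2)))
                 (mulseq mul s (mulseq mul s (mulseq mul s [:: y *+ 2]))).
have E t : vhorner l t = vhorner r t.
  have vhorner1 v : vhorner [:: v] t = v by rewrite /= scaler0 addr0.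
  by rewrite !vhornerM 2!vhornerD !vhornerM !vhorner1 albert31.
have /(_ 1%N) := vhorner_coefs_eq charF E isT isT.
rewrite /= !(addr0, add0r) !(linearDr, linearDl).
rewrite !(mulC z x) !(mulC z y) !(mulC _ (mul x x)) !(mulC (mul x z)).
move/eq_by_sub; apply.
set a1 := mul (mul x x) (mul y z); set a2 := mul (mul x y) (mul x z).
set a3 := mul x (mul x (mul y z)); set a4 := mul x (mul y (mul x z)).
set a5 := mul x (mul z (mul x y)); set a6 := mul y (mul x (mul x z)).
set a7 := mul y (mul (mul x x) z); set a8 := mul z (mul x (mul x y)).
set a9 := mul z (mul (mul x x) y).
linear_identity [:: a1; a2; a3; a4; a5; a6; a7; a8; a9].
Qed.

End Albert.
End Identities.

(** * Powers *)

(** With d2, ..., d5 in place of d 2, ..., d 5, these are the relations of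
    [albert_recurrence] for (a, b) = (1, 1), (1, 2), (1, 3) and (2, 1). *)
Lemma albert_elimination (F : fieldType) (V : lmodType F) (d2 d3 d4 d5 : V) :
    d2 *+ 4 + d2 *+ 8 = d3 *+ 3 ->
    d2 *+ 4 + d3 *+ 8 = d2 *+ 3 + d4 *+ 3 ->
    d2 *+ 4 + d4 *+ 8 = d3 *+ 3 + d5 *+ 3 ->
    d4 *+ 4 + d3 *+ 8 = d2 *+ 6 + d5 *+ 3 ->
  d2 *+ 90 = 0.
Proof.
move=> E3 E4 E5 E45.
(* d5 disappears from the difference of the last two relations, then d4 and
   d3 are eliminated with the second and the first one. *)
transitivity ((d2 *+ 4 + d4 *+ 8 - (d3 *+ 3 + d5 *+ 3)) *+ 9
            - (d4 *+ 4 + d3 *+ 8 - (d2 *+ 6 + d5 *+ 3)) *+ 9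
            + (d2 *+ 4 + d3 *+ 8 - (d2 *+ 3 + d4 *+ 3)) *+ 12
            - (d2 *+ 4 + d2 *+ 8 - d3 *+ 3)).
  linear_identity [:: d2; d3; d4; d5].
by rewrite E3 E4 E5 E45 !subrr !mul0rn !subr0 addr0.
Qed.

(** For n >= 6 the relations of [albert_elimination] are available. For n = 5
    the symmetry gives d 3 = d 2, and the first of them is 9 d 2 = 0. Once
    d 2 = 0, the relations with a = 1 give d (k + 2) from d k and d (k + 1). *)
Lemma albert_recurrence (F : fieldType) (V : lmodType F)
    (charF : forall p : nat, p \in [pchar F] -> ~~ (p %| 30)%N)
    (n : nat) (d : nat -> V) : (4 < n)%N ->
    d 1%N = 0 ->
    (forall i, (0 < i < n)%N -> d i = d (n - i)%N) ->
    (forall a b c,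
        (0 < a)%N -> (0 < b)%N -> (0 < c)%N -> (a + a + b + c = n)%N ->
      d (a + a)%N *+ 4 + d (a + b)%N *+ 8 = d a *+ 6 + d b *+ 3 + d c *+ 3) ->
  forall i, (0 < i < n)%N -> d i = 0.
Proof.
move=> n_gt4 d1 dC dE.
have rec c : (0 < c)%N -> (c.+2 < n)%N ->
    d 2%N *+ 4 + d c.+1 *+ 8 = d c *+ 3 + d c.+2 *+ 3.
  move=> c_gt0 lt_c_n; have := dE 1%N c (n - c.+2)%N isT c_gt0.
  rewrite subn_gt0 lt_c_n d1 mul0rn add0r -dC; last lia.
  by apply; lia.
have d2 : d 2%N = 0.
  have := rec 1%N isT; rewrite d1 mul0rn add0r; move=> /(_ ltac:(lia)) E3.
  have [n5|n_neq5] := eqVneq n 5%N.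
    apply: (mulrn_inj0 charF (n := 9)) => //.
    move: E3; rewrite (dC 3) ?n5 // => /eq_by_sub; apply.
    linear_identity [:: d 2%N].
  have E4 := rec 2%N isT ltac:(lia); have E5 := rec 3%N isT.
  have := dE 2%N 1%N (n - 5)%N isT isT; rewrite d1 mul0rn addr0 -dC; last lia.
  move=> /(_ ltac:(lia) ltac:(lia)) E45.
  apply: (mulrn_inj0 charF (n := 90)) => //.
  by apply: albert_elimination E3 E4 (E5 _) E45; lia.
have step c : (0 < c)%N -> (c.+2 < n)%N -> d c = 0 -> d c.+1 = 0 -> d c.+2 = 0.
  move=> c_gt0 lt_c_n dc dc1; apply: (mulrn_inj0 charF (n := 3)) => //.
  by have := rec c c_gt0 lt_c_n; rewrite d2 dc dc1 !mul0rn !add0r => <-.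
have d_adj k : (k.+2 < n)%N -> d k.+1 = 0 /\ d k.+2 = 0.
  elim: k => [|k IHk] lt_k_n //; have [|dk dk1] := IHk; first by lia.
  by split=> //; apply: step.
move=> [|[|i]] //= lt_i_n.
by have [] := d_adj i lt_i_n.
Qed.

Section Powers.
Variables (F : fieldType) (A : lmodType F) (mul : {bilinear A -> A -> A}).
Hypothesis charF : forall p : nat, p \in [pchar F] -> ~~ (p %| 30)%N.
Hypothesis mulC : commutative mul.
Hypothesis albert :
  forall x : A, mul (mul x x) (mul x x) = mul x (mul x (mul x x)).
Variable e : A.
Hypothesis mul1x : left_id e mul.

Definition power (x : A) (n : nat) : A := iter n (mul x) e.

Lemma powerS (x : A) (n : nat) : power x n.+1 = mul x (power x n).
Proof. by []. Qed.

Lemma power1 (x : A) : power x 1 = x.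
Proof. by rewrite powerS mulC mul1x. Qed.

(** Induction on the total degree n = i + j. For n >= 5 the defects [d] satisfy
    the hypotheses of [albert_recurrence]; for n <= 4, up to commutativity and
    the unit, only x^2 x^2 = x^4 is not true by definition. *)
Lemma powerD (x : A) (i j : nat) :
  mul (power x i) (power x j) = power x (i + j).
Proof.
have [n] := ubnP (i + j); elim: n i j => // n IHn i j; rewrite ltnS => le_ij_n.
case: i le_ij_n => [|i] le_ij_n; first by rewrite mul1x.
case: j le_ij_n => [|j] le_ij_n; first by rewrite mulC mul1x addn0.
have [/IHn//|n_le] := ltnP (i.+1 + j.+1) n.
have {n_le le_ij_n} def_n : (i.+1 + j.+1)%N = n by lia.
pose d k := mul (power x k) (power x (n - k)) - power x n.
have mulE k l : (k + l = n)%N -> mul (power x k) (power x l) = d k + power x n.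
  by move=> kl; rewrite /d subrK -kl addKn.
have d1 : d 1%N = 0.
  by rewrite /d power1 -powerS subn1 prednK ?subrr -?def_n.
have dC k : (0 < k < n)%N -> d k = d (n - k)%N.
  by move=> lt_k_n; rewrite /d mulC subKn //; lia.
suff dk : forall k, (0 < k < n)%N -> d k = 0.
  by rewrite (mulE _ _ def_n) dk ?add0r ?def_n //; lia.
(* In the polarized identity at powers of x all inner products have degree less
   than n, so each term becomes d k + x^n; the x^n cancel, 12 on each side. *)
have dE a b c : (0 < a)%N -> (0 < b)%N -> (0 < c)%N -> (a + a + b + c)%N = n ->
    d (a + a)%N *+ 4 + d (a + b)%N *+ 8 = d a *+ 6 + d b *+ 3 + d c *+ 3.
  move=> a_gt0 b_gt0 c_gt0 sum_n.
  have := albert211 charF mulC albert (power x a) (power x b) (power x c).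
  rewrite (IHn a a) ?(IHn b c) ?(IHn a b) ?(IHn a c) ?(IHn c b); try lia.
  rewrite !linearDr.
  rewrite (IHn a (b + c)%N) ?(IHn b (a + c)%N) ?(IHn c (a + b)%N); try lia.
  rewrite (IHn a (a + c)%N) ?(IHn c (a + a)%N) ?(IHn a (a + b)%N); try lia.
  rewrite (IHn b (a + a)%N); last lia.
  rewrite !mulE; try lia.
  move/eq_by_sub; apply.
  linear_identity [:: d (a + a)%N; d (a + b)%N; d a; d b; d c; power x n].
have [n_gt4|n_le4] := ltnP 4 n; first exact: albert_recurrence.
move=> k; have [->|k_neq1] := eqVneq k 1%N; first by [].
have [k_last|k_neq] := eqVneq k n.-1.
  by rewrite k_last => k_lt; rewrite dC -?d1 //; congr d; lia.
move=> k_lt; have [n4 ->] : n = 4%N /\ k = 2%N by lia.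
have square : power x 2 = mul x x by rewrite powerS power1.
by rewrite /d n4 square (powerS x 3) (powerS x 2) square albert subrr.
Qed.

Lemma umbral_powerM (x : A) (p q : {poly F}) :
  umbral (power x) (p * q) = mul (umbral (power x) p) (umbral (power x) q).
Proof.
have monomial i j :
    umbral (power x) ('X^i * 'X^j) =
    mul (umbral (power x) 'X^i) (umbral (power x) 'X^j).
  by rewrite -exprD !umbralXn powerD.
rewrite -[p]coefK poly_def mulr_suml !(linear_sum (umbral (power x))) /=.
rewrite linear_sumlz.
apply: eq_bigr => i _.
rewrite -scalerAl !linearZ /= linearZl_LR; congr (_ *: _).
rewrite -[q]coefK poly_def mulr_sumr !(linear_sum (umbral (power x))) /=.
rewrite linear_sumr.
by apply: eq_bigr => j _; rewrite -scalerAr !linearZ /= monomial.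
Qed.

(** The span of the powers of x, including x^0 = e, may be larger than the
    generated subalgebra, but [umbral_powerM] makes it a subalgebra. *)
Lemma generated_subalgebra_umbral (x y : A) :
  generated_subalgebra mul x y -> exists p, y = umbral (power x) p.
Proof.
move=> gen_y; apply: (gen_y (fun z => exists p, z = umbral (power x) p)).
  split.
  - by exists 0; rewrite linear0.
  - by move=> u v [p ->] [q ->]; exists (p + q); rewrite linearD.
  - by move=> a u [p ->]; exists (a *: p); rewrite linearZ.
  - by move=> u v [p ->] [q ->]; exists (p * q); rewrite umbral_powerM.
by exists 'X; rewrite -['X]expr1 umbralXn power1.
Qed.

End Powers.

Theorem proposition6p4 (F : fieldType)
    (charF : forall p : nat, p \in [pchar F] -> ~~ (p %| 30)%N)
    (A : lmodType F) (mul : {bilinear A -> A -> A})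
    (mulC : commutative mul) (mul1 : unital mul)
    (mulP : palintropic23 mul) :
  power_associative mul.
Proof.
have [e [mul1x _]] := mul1.
have albert x := albert_of_palintropic charF mulC x mul1x mulP.
move=> x u v w.
do 3![move/(generated_subalgebra_umbral charF mulC albert mul1x) => [? ->]].
by rewrite -!(umbral_powerM charF mulC albert mul1x) mulrA.
Qed.
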